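(* Let $G$ be a $(p,q)$-graph with $q\ge 1$. If $G$ is $k$-super graceful for some $k\ge 1$ via a $k$-super graceful labeling in which every vertex receives an odd label, then $G$ is a $(q+1,q)$-graph (i.e. $p=q+1$) and $k=1$.
   Context: All graphs are simple, finite, undirected and without isolated vertices; a $(p,q)$-graph has $p$ vertices and $q$ edges. For integers $a\le b$, $[a,b]$ denotes the set of integers $x$ with $a\le x\le b$. For $k\ge 1$, a $k$-super graceful labeling of a $(p,q)$-graph $G=(V,E)$ is a bijection $f:V\cup E\to[k,k+p+q-1]$ such that $f(uv)=|f(u)-f(v)|$ for every edge $uv\in E$; $G$ is $k$-super graceful if it admits one. *)

(* Defs.v *)
From mathcomp Require Import all_boot all_order all_algebra.
Set Implicit Arguments.
Unset Strict Implicit.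
Unset Printing Implicit Defensive.
Import IntDist.

Record sgraph := SGraph {
  vertex : finType;
  adj : rel vertex;
  adj_sym : symmetric adj;
  adj_irrefl : irreflexive adj
}.

Definition no_isolated_vertex (G : sgraph) : Prop :=
  forall u : vertex G, exists v : vertex G, adj u v.

(* Each undirected edge uv is counted once, as the two-element set {u, v}. *)
Definition edges (G : sgraph) : {set {set vertex G}} :=
  [set A : {set vertex G} |
     [exists u, exists v, adj u v && (A == [set u; v])]].

Definition edge (G : sgraph) := {A : {set vertex G} | A \in edges G}.

Definition pq_graph (p q : nat) (G : sgraph) : Prop :=
  #|vertex G| = p /\ #|edges G| = q.

Definition bijective_onto_interval (X : Type) (f : X -> nat) (a b : nat) : Prop :=
  [/\ forall x, a <= f x <= b,
      injective f
    & forall n, a <= n <= b -> exists x, f x = n].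

(* The disjoint union of V and E is the sum type; for k >= 1 the truncated
   subtraction in the upper bound is the ordinary one. *)
Definition super_graceful_labeling (k : nat) (G : sgraph)
    (f : vertex G + edge G -> nat) : Prop :=
  bijective_onto_interval f k (k + #|vertex G| + #|edges G| - 1) /\
  forall (e : edge G) (u v : vertex G),
    val e = [set u; v] -> f (inr e) = `|f (inl u) - f (inl v)|%N.

(* Main.v *)
Require Import Defs.
From mathcomp Require Import all_boot all_order all_algebra.
From mathcomp Require Import zify.

(** All edge labels are even, being differences of odd numbers, so the vertices
    carry exactly the odd labels and the edges exactly the even ones.  Let [T]
    be the top label.  The larger even number among [T - 1] and [T] is a
    difference of two labels of [[k, T]], hence at most [T - k]; this forces
    [k = 1] and [T = p + q] odd.  Counting the odd numbers up to [p + q] then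
    gives [p = q + 1]. *)

Lemma edge_ends (G : sgraph) (e : edge G) : exists u v, val e = [set u; v].
Proof.
case: e => A /=; rewrite inE => /existsP[u /existsP[v /andP[_ /eqP ->]]].
by exists u, v.
Qed.

Lemma count_odd_iota1 n : count odd (iota 1 n) = uphalf n.
Proof. by elim: n => // n IHn; rewrite -(addn1 n) iotaD count_cat IHn /=; lia. Qed.

Theorem theorem2p8 (G : sgraph) (p q k : nat) :
  no_isolated_vertex G ->
  pq_graph p q G ->
  1 <= q ->
  1 <= k ->
  (exists f : vertex G + edge G -> nat,
     super_graceful_labeling k f /\ forall v : vertex G, odd (f (inl v))) ->
  p = q + 1 /\ k = 1.
Proof.
move=> _ [card_V card_E] q_gt0 k_gt0 [f [[[f_itv f_inj f_onto] f_edge] f_odd]].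
rewrite card_V card_E in f_itv f_onto; set T := k + p + q - 1 in f_itv f_onto.
have edge_label e : ~~ odd (f (inr e)) /\ f (inr e) <= T - k.
  have [u [v uvE]] := edge_ends _ e; rewrite (f_edge e u v uvE).
  have := f_odd u; have := f_odd v.
  have := f_itv (inl u); have := f_itv (inl v); lia.
have even_le m : k <= m <= T -> ~~ odd m -> m <= T - k.
  move=> /f_onto[[v|e] <-]; first by rewrite f_odd.
  by have [] := edge_label e.
(* An odd vertex label and an even edge label are two distinct elements of [[k, T]]. Hence [even_le]
   also applies to [T - 1]. *)
have lt_kT : k < T.
  have /card_gt0P[A EA] : 0 < #|edges G| by rewrite card_E.
  pose e : edge G := exist _ A EA; have [u _] := edge_ends _ e.
  have [] := edge_label e; have := f_odd u.
  by have := f_itv (inl u); have := f_itv (inr e); lia.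
have := even_le T; have := even_le (T - 1) => evT1 evT.
(* Even [T] would give [T <= T - k], against [k >= 1]; odd [T] gives [T - 1 <= T - k]. *)
have k1 : k = 1 by case: (boolP (odd T)); lia.
have oddT : odd T by apply/negP; lia.
(* Here [T = p + q] is odd, so the claim reads [2p = p + q + 1]. *)
split=> //; suff : p = uphalf T by lia.
(* Both sides become sizes of duplicate-free lists: the vertex labels and the odd numbers of
   [[1, T]]. *)
rewrite -count_odd_iota1 -size_filter -card_V cardE -(size_map (f \o inl)).
apply/perm_size/uniq_perm => [||n]; rewrite ?filter_uniq ?iota_uniq //.
  by rewrite map_inj_uniq ?enum_uniq // => u v /f_inj[].
rewrite mem_filter mem_iota; apply/mapP/idP => [[v _ ->]|/andP[odd_n itv_n]].
  by rewrite /= f_odd add1n ltnS -k1 f_itv.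
have [|[v|e] fn] := f_onto n; first lia; first by exists v; rewrite ?mem_enum.
by have [] := edge_label e; rewrite fn odd_n.
Qed.
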